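(* Let $\mathcal{X}=(X,d_X,f_X)$ be any finite augmented metric space where $d_X$ is an ultrametric, i.e. $d_X(x,x'')\le\max(d_X(x,x'),d_X(x',x''))$ for all $x,x',x''\in X$. Then $\mathrm{H}_0(\mathcal{R}^{\mathrm{bi}}_\bullet(\mathcal{X})):\mathbb{R}^2\to\mathbf{Vec}$ is interval decomposable, and in fact its barcode consists solely of infinite rectangular intervals, i.e. unbounded sets of the form $[a,b)\times[c,d)\subseteq\mathbb{R}^2$ with $b,d\in\mathbb{R}\cup\{\infty\}$.
   Context: **Augmented metric spaces and Rips bifiltration.** A finite augmented metric space is a triple $\mathcal{X}=(X,d_X,f_X)$ with $(X,d_X)$ a finite metric space and $f_X:X\to\mathbb{R}$. Put $X_\sigma=\{x\in X: f_X(x)\le\sigma\}$. $\mathcal{R}_\varepsilon(X_\sigma,d_X)$ is the simplicial complex whose simplices are the nonempty $A\subseteq X_\sigma$ with $d_X(a,a')\le\varepsilon$ for all $a,a'\in A$ (empty if $\varepsilon<0$). The Rips bifiltration $\mathcal{R}^{\mathrm{bi}}_\bullet(\mathcal{X})$ is the functor on $\mathbb{R}^2$ (product order) sending $(\sigma,\varepsilon)$ to $\mathcal{R}_\varepsilon(X_\sigma,d_X)$, with inclusions as internal maps. $\mathrm{H}_0$ is simplicial homology with coefficients in a fixed field $\mathbb{F}$; $\mathbf{Vec}$ is the category of finite-dimensional $\mathbb{F}$-vector spaces. **Interval decomposability.** For a poset $\mathbb{P}$, an interval $\mathcal{J}\subseteq\mathbb{P}$ is a nonempty, convex ($a,b\in\mathcal{J}$,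 $a\le c\le b$ imply $c\in\mathcal{J}$) subset in which any two elements are joined by a finite sequence of elements of $\mathcal{J}$ with consecutive elements comparable. The interval module $I^{\mathcal{J}}$ is $\mathbb{F}$ on $\mathcal{J}$ with identity internal maps within $\mathcal{J}$, and $0$ elsewhere. A functor $N:\mathbb{P}\to\mathbf{Vec}$ is interval decomposable if $N\cong\bigoplus_{\mathcal{J}\in B}I^{\mathcal{J}}$ for some multiset $B$ of intervals; $B$ is then unique and is called the barcode of $N$. *)

(* Defs.v *)
From HB Require Import structures.
From mathcomp Require Import all_boot all_order all_algebra.
From mathcomp Require Import boolp classical_sets cardinality.
From mathcomp Require Import reals ereal normedtype.
Set Implicit Arguments.
Unset Strict Implicit.
Unset Printing Implicit Defensive.
Import Order.TTheory GRing.Theory Num.Theory numFieldNormedType.Exports.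
Local Open Scope quotient_scope.
Local Open Scope classical_set_scope.
Local Open Scope ring_scope.

Section PersistenceModules.
Variables (F : fieldType) (d : Order.disp_t) (P : porderType d).

Record pmod := Pmod {
  pm_obj :> P -> lmodType F;
  pm_map : forall p q : P, (p <= q)%O -> {linear pm_obj p -> pm_obj q};
  pm_map_id : forall (p : P) (h : (p <= p)%O) v, pm_map h v = v;
  pm_map_comp : forall (p q r : P) (hpq : (p <= q)%O) (hqr : (q <= r)%O)
      (hpr : (p <= r)%O) v,
    pm_map hpr v = pm_map hqr (pm_map hpq v) }.

Definition pointwise_fd (N : pmod) : Prop :=
  forall p, exists (n : nat) (h : {linear N p -> 'rV[F]_n}), bijective h.

Record vecmod := Vecmod {
  vecmod_pmod :> pmod;
  vecmod_fd : pointwise_fd vecmod_pmod }.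

Definition pmod_iso (M N : pmod) : Prop :=
  exists phi : forall p, {linear M p -> N p},
    (forall p, bijective (phi p)) /\
    (forall p q (h : (p <= q)%O) v, phi q (pm_map M h v) = pm_map N h (phi p v)).

End PersistenceModules.

Section DirectSum.
Variables (F : fieldType) (I : Type).

Record dsum (V : I -> lmodType F) := Dsum {
  dsum_fun :> forall i, V i;
  dsum_fin : finite_set [set i | dsum_fun i != 0] }.

HB.instance Definition _ V := gen_eqMixin (dsum V).
HB.instance Definition _ V := gen_choiceMixin (dsum V).

Lemma dsumP V (f g : dsum V) : (forall i, f i = g i) -> f = g.
Proof.
case: f g => f hf [g hg] /= e.
have {}e : f = g by apply: functional_extensionality_dep.
by case: g / e hg => hg; congr Dsum; apply: Prop_irrelevance.
Qed.

Section Ops.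
Variable V : I -> lmodType F.

Lemma dsum0_fin : finite_set [set i | (0 : V i) != 0].
Proof. by apply: (sub_finite_set _ (finite_set0 I)) => i /=; rewrite eqxx. Qed.

Lemma dsumD_fin (f g : dsum V) : finite_set [set i | f i + g i != 0].
Proof.
have fin : finite_set ([set i | f i != 0] `|` [set i | g i != 0]).
  by rewrite finite_setU; split; apply: dsum_fin.
apply: (sub_finite_set _ fin) => i /= h; have [f0|] := eqVneq (f i) 0; last by left.
by right; move: h; rewrite f0 add0r.
Qed.

Lemma dsumN_fin (f : dsum V) : finite_set [set i | - f i != 0].
Proof. by apply: (sub_finite_set _ (dsum_fin f)) => i /=; rewrite oppr_eq0. Qed.

Lemma dsumZ_fin a (f : dsum V) : finite_set [set i | a *: f i != 0].
Proof.
apply: (sub_finite_set _ (dsum_fin f)) => i /=.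
by apply: contraNneq => ->; rewrite scaler0.
Qed.

Definition dsum0 := Dsum dsum0_fin.
Definition dsumD f g := Dsum (dsumD_fin f g).
Definition dsumN f := Dsum (dsumN_fin f).
Definition dsumZ a f := Dsum (dsumZ_fin a f).

Fact dsumDA : associative dsumD.
Proof. by move=> f g h; apply: dsumP => i /=; rewrite addrA. Qed.
Fact dsumDC : commutative dsumD.
Proof. by move=> f g; apply: dsumP => i /=; rewrite addrC. Qed.
Fact dsum0D : left_id dsum0 dsumD.
Proof. by move=> f; apply: dsumP => i /=; rewrite add0r. Qed.
Fact dsumND : left_inverse dsum0 dsumN dsumD.
Proof. by move=> f; apply: dsumP => i /=; rewrite addNr. Qed.
HB.instance Definition _ :=
  GRing.isZmodule.Build (dsum V) dsumDA dsumDC dsum0D dsumND.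

Fact dsumZA a b f : dsumZ a (dsumZ b f) = dsumZ (a * b) f.
Proof. by apply: dsumP => i /=; rewrite scalerA. Qed.
Fact dsum1Z : left_id 1 dsumZ.
Proof. by move=> f; apply: dsumP => i /=; rewrite scale1r. Qed.
Fact dsumZDr : right_distributive dsumZ +%R.
Proof. by move=> a f g; apply: dsumP => i /=; rewrite scalerDr. Qed.
Fact dsumZDl f : {morph dsumZ^~ f : a b / a + b}.
Proof. by move=> a b; apply: dsumP => i /=; rewrite scalerDl. Qed.
HB.instance Definition _ :=
  GRing.Zmodule_isLmodule.Build F (dsum V) dsumZA dsum1Z dsumZDr dsumZDl.

End Ops.

Section Map.
Variables (V W : I -> lmodType F) (phi : forall i, {linear V i -> W i}).

Lemma dsum_map_fin (f : dsum V) : finite_set [set i | phi i (f i) != 0].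
Proof.
apply: (sub_finite_set _ (dsum_fin f)) => i /=.
by apply: contraNneq => ->; rewrite linear0.
Qed.

Definition dsum_map (f : dsum V) : dsum W := Dsum (dsum_map_fin f).

Fact dsum_map_linear : linear dsum_map.
Proof. by move=> a f g; apply: dsumP => i /=; rewrite linearP. Qed.
HB.instance Definition _ :=
  GRing.isLinear.Build F (dsum V) (dsum W) _ dsum_map dsum_map_linear.

End Map.

Variables (d : Order.disp_t) (P : porderType d) (M : I -> pmod F P).

Definition pmod_dsum : pmod F P.
Proof.
refine (@Pmod F d P (fun p => dsum (fun i => M i p))
  (fun p q h => dsum_map (fun i => pm_map (M i) h)) _ _).
- by move=> p h f; apply: dsumP => i /=; rewrite pm_map_id.
- by move=> p q r hpq hqr hpr f; apply: dsumP => i /=; apply: pm_map_comp.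
Defined.

End DirectSum.

Section Intervals.
Variables (F : fieldType) (d : Order.disp_t) (P : porderType d).

Record poset_interval := PosetInterval {
  interval_set :> set P;
  interval_nonempty : interval_set !=set0;
  interval_convex : forall a b c : P, interval_set a -> interval_set b ->
    (a <= c)%O -> (c <= b)%O -> interval_set c;
  interval_connected : forall a b : P, interval_set a -> interval_set b ->
    exists s : seq P, [/\ path (fun x y => x >=< y)%O a s, last a s = b &
      forall c, c \in s -> interval_set c] }.

Variable J : poset_interval.

(* The value at p is F^1 if p belongs to J and F^0 otherwise; pid_mx 1 is the *)
(* identity matrix between copies of F^1 and the zero matrix otherwise.       *)
Definition interval_obj (p : P) : lmodType F := 'rV[F]_(`[< interval_set J p >]).

Definition interval_map (p q : P) : {linear interval_obj p -> interval_obj q} :=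
  mulmxr (pid_mx 1).

Definition interval_pmod : pmod F P.
Proof.
refine (@Pmod F d P interval_obj (fun p q _ => interval_map p q) _ _).
- move=> p _ v /=; rewrite -[RHS]mulmx1; congr (_ *m _).
  by apply/matrixP=> i j; rewrite !mxE; case: `[< interval_set J p >] i j {v} => -[[|i] hi] [[|j] hj].
- move=> p q r hpq hqr hpr v /=; rewrite -mulmxA; congr (_ *m _).
  rewrite mul_pid_mx; case: (asboolP (interval_set J q)) => // nJq.
  apply/matrixP=> i j; rewrite !mxE /=.
  case: (asboolP (interval_set J p)) i {v} => [Jp|_] [i hi] //=.
  case: (asboolP (interval_set J r)) j => [Jr|_] [j hj] //=.
  by case: nJq; apply: interval_convex Jp Jr hpq hqr.
Defined.

Fact interval_pmod_fd : pointwise_fd interval_pmod.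
Proof. by move=> p; exists (`[< interval_set J p >] : nat), idfun; exists idfun. Qed.

Definition interval_module : vecmod F P := Vecmod interval_pmod_fd.

End Intervals.

(* A multiset is encoded as an indexed family, multiplicities as repetitions. *)
Record interval_multiset d (P : porderType d) := IntervalMultiset {
  ims_index : Type;
  ims_interval :> ims_index -> poset_interval P }.

Definition is_barcode (F : fieldType) d (P : porderType d)
    (N : vecmod F P) (B : interval_multiset P) : Prop :=
  pmod_iso N (pmod_dsum (fun i => interval_module F (B i))).

Definition interval_decomposable (F : fieldType) d (P : porderType d)
    (N : vecmod F P) : Prop :=
  exists B : interval_multiset P, is_barcode N B.

Definition quotv (F : fieldType) (V : vectType F) (U : {vspace V}) : Type :=
  Quotient.quot [the zmodClosed V of pred_of_vspace U].

Section QuotientSpace.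
Variables (F : fieldType) (V : vectType F) (U : {vspace V}).

HB.instance Definition _ := GRing.Zmodule.on (quotv U).

Definition quotv_pi (v : V) : quotv U := \pi v.
Definition quotv_repr (x : quotv U) : V := repr x.

Lemma quotv_reprK : cancel quotv_repr quotv_pi.
Proof. exact: reprK. Qed.

Lemma quotv_piP v w : quotv_pi v = quotv_pi w <-> v - w \in U.
Proof.
have -> : (v - w \in U) = (quotv_pi v == quotv_pi w).
  exact: (Quotient.idealrBE [the zmodClosed V of pred_of_vspace U]).
by split=> [->|/eqP].
Qed.

Lemma quotv_piD v w : quotv_pi (v + w) = quotv_pi v + quotv_pi w.
Proof. exact: (raddfD \pi_(Quotient.quot [the zmodClosed V of pred_of_vspace U])). Qed.

Definition quotv_scale (a : F) (x : quotv U) := quotv_pi (a *: quotv_repr x).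

Lemma quotv_piZ a v : quotv_pi (a *: v) = quotv_scale a (quotv_pi v).
Proof.
apply/quotv_piP; rewrite -scalerBr rpredZ //.
by apply/quotv_piP; rewrite quotv_reprK.
Qed.

Fact quotv_scaleA a b x : quotv_scale a (quotv_scale b x) = quotv_scale (a * b) x.
Proof. by rewrite -[x]quotv_reprK -!quotv_piZ scalerA. Qed.
Fact quotv_scale1 : left_id 1 quotv_scale.
Proof. by move=> x; rewrite -[x]quotv_reprK -!quotv_piZ scale1r. Qed.
Fact quotv_scaleDr : right_distributive quotv_scale +%R.
Proof.
move=> a x y; rewrite -[x]quotv_reprK -[y]quotv_reprK.
by rewrite -quotv_piD -!quotv_piZ -quotv_piD scalerDr.
Qed.
Fact quotv_scaleDl x : {morph quotv_scale^~ x : a b / a + b}.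
Proof.
by move=> a b; rewrite -[x]quotv_reprK -!quotv_piZ -quotv_piD scalerDl.
Qed.
HB.instance Definition _ := GRing.Zmodule_isLmodule.Build F (quotv U)
  quotv_scaleA quotv_scale1 quotv_scaleDr quotv_scaleDl.

Fact quotv_pi_linear : linear quotv_pi.
Proof. by move=> a v w; rewrite quotv_piD quotv_piZ. Qed.
HB.instance Definition _ :=
  GRing.isLinear.Build F V (quotv U) _ quotv_pi quotv_pi_linear.

Fact quotv_vect_iso : Vector.axiom (\dim (U^C)%VS) (quotv U).
Proof.
pose C := (U^C)%VS.
have UC : (U :&: C = 0)%VS by exact: capv_compl.
have CU : (C :&: U = 0)%VS by rewrite capvC.
have tot v : v \in (C + U)%VS by rewrite addvC addv_complf memvf.
pose h (x : quotv U) : subvs_of C := vsproj C (daddv_pi C U (quotv_repr x)).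
have hpi v : h (quotv_pi v) = vsproj C (daddv_pi C U v).
  apply/eqP; rewrite -subr_eq0 -linearB -linearB /=.
  have vU : quotv_repr (quotv_pi v) - v \in U.
    by apply/quotv_piP; rewrite quotv_reprK.
  have := daddv_pi_add CU (tot (quotv_repr (quotv_pi v) - v)).
  rewrite (daddv_pi_id UC vU) => /(canRL (addrK _)); rewrite subrr => ->.
  by rewrite linear0.
have hlin : linear h.
  move=> a x y; rewrite -[x]quotv_reprK -[y]quotv_reprK -linearP /= !hpi.
  by rewrite !linearP.
have hK : cancel h (fun w => quotv_pi (vsval w)).
  move=> x; rewrite -{1}[x]quotv_reprK hpi vsprojK ?memv_pi //.
  rewrite -[RHS]quotv_reprK; apply/quotv_piP.
  rewrite -{2}(daddv_pi_add CU (tot (quotv_repr x))).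
  by rewrite opprD addrA subrr add0r rpredN memv_pi.
have Kh : cancel (fun w => quotv_pi (vsval w)) h.
  by move=> w; rewrite hpi daddv_pi_id ?subvsP // vsvalK.
have [g glin gbij] : Vector.axiom (\dim C) (subvs_of C) := subvs_vect_iso C.
exists (g \o h); first by move=> a x y /=; rewrite hlin glin.
by apply: bij_comp gbij _; exists (fun w => quotv_pi (vsval w)).
Qed.
HB.instance Definition _ := Lmodule_hasFinDim.Build F (quotv U) quotv_vect_iso.

End QuotientSpace.

Section QuotientMap.
Variables (F : fieldType) (V W : vectType F) (f : {linear V -> W}).
Variables (U : {vspace V}) (U' : {vspace W}).

Definition quotv_map (fU : forall v, v \in U -> f v \in U') (x : quotv U) :
  quotv U' := quotv_pi U' (f (quotv_repr x)).

Variable fU : forall v, v \in U -> f v \in U'.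

Lemma quotv_map_pi v : quotv_map fU (quotv_pi U v) = quotv_pi U' (f v).
Proof.
apply/quotv_piP; rewrite -linearB; apply: fU.
by apply/quotv_piP; rewrite quotv_reprK.
Qed.

Fact quotv_map_linear : linear (quotv_map fU).
Proof.
move=> a x y; rewrite -[x]quotv_reprK -[y]quotv_reprK.
by rewrite -linearP !quotv_map_pi !linearP.
Qed.
HB.instance Definition _ := GRing.isLinear.Build F (quotv U) (quotv U') _
  (quotv_map fU) quotv_map_linear.

End QuotientMap.

Record simplicial_complex (T : finType) := SimplicialComplex {
  simplices :> {set {set T}};
  simplices_neq0 : forall A, A \in simplices -> A != finset.set0;
  simplices_sub : forall A B : {set T},
    A \in simplices -> B != finset.set0 -> B \subset A -> B \in simplices }.

Section Homology.
Variables (F : fieldType) (T : finType).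
Implicit Types K L : simplicial_complex T.

(* Chains are functions on all subsets of T. Simplices are oriented by the    *)
(* enumeration order of T.                                                    *)
Definition chain : vectType F := {ffun {set T} -> F^o}.

Definition basis_chain (A : {set T}) : chain := [ffun B => (B == A)%:R].

Definition face_sign (A : {set T}) (x : T) : F :=
  (-1) ^+ #|[set y in A | (enum_rank y < enum_rank x)%N]|.

(* Faces that are empty are discarded: the complex is not augmented.          *)
Definition boundary_fun (c : chain) : chain :=
  \sum_(A : {set T}) c A *:
    \sum_(x in A | A :\ x != finset.set0) face_sign A x *: basis_chain (A :\ x).

Fact boundary_fun_linear : linear boundary_fun.
Proof.
move=> a c c'; rewrite /boundary_fun scaler_sumr -big_split /=.
by apply: eq_bigr => A _; rewrite !ffunE scalerDl scalerA.
Qed.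
HB.instance Definition _ :=
  GRing.isLinear.Build F chain chain _ boundary_fun boundary_fun_linear.

Definition boundary : 'End(chain) := linfun boundary_fun.

Definition chains (n : nat) K : {vspace chain} :=
  <<[seq basis_chain A | A : {set T} <- enum (simplices K) & #|A| == n.+1]>>%VS.

Definition cycles n K : {vspace chain} := (chains n K :&: lker boundary)%VS.

Definition boundaries n K : {vspace chain} := (boundary @: chains n.+1 K)%VS.

Lemma boundary_basis A : boundary (basis_chain A) =
  \sum_(x in A | A :\ x != finset.set0) face_sign A x *: basis_chain (A :\ x).
Proof.
rewrite lfunE /= /boundary_fun (bigD1 A) //= [X in _ + X]big1 => [|B BA].
  by rewrite addr0 ffunE eqxx scale1r.
by rewrite ffunE (negPf BA) scale0r.
Qed.

Lemma face_sign_lt (A : {set T}) x y : x \in A -> (enum_rank x < enum_rank y)%N ->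
  face_sign (A :\ y) x = face_sign A x /\ face_sign (A :\ x) y = - face_sign A y.
Proof.
move=> xA xy; split; rewrite /face_sign.
  congr (_ ^+ _); apply: eq_card => z; rewrite !inE.
  by case: eqVneq => //= ->; rewrite [RHS]andbC ltnNge (ltnW xy).
rewrite [in RHS](cardsD1 x) !inE xA xy /= exprS mulN1r opprK.
congr (_ ^+ _); apply: eq_card => z; rewrite !inE.
by rewrite andbA.
Qed.

Lemma boundary_boundary c : boundary (boundary c) = 0.
Proof.
suff bb A : boundary (boundary (basis_chain A)) = 0.
  rewrite [boundary c]lfunE /= /boundary_fun linear_sum big1 // => A _.
  by rewrite linearZ -boundary_basis /= bb scaler0.
pose t x y : chain := (face_sign A x * face_sign (A :\ x) y) *:
  basis_chain (A :\ x :\ y).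
pose Q x y := [&& x \in A, y \in A & A :\ x :\ y != finset.set0].
transitivity (\sum_x \sum_(y | Q x y && (x != y)) t x y).
  rewrite boundary_basis linear_sum [LHS]big_mkcond /=; apply: eq_bigr => x _.
  case: ifPn => [/andP[xA _]|nx].
    rewrite linearZ /= boundary_basis scaler_sumr; apply: eq_big => [y|y _].
      by rewrite !inE /Q xA eq_sym /=; case: eqVneq; rewrite ?andbF ?andbT.
    by rewrite scalerA.
  rewrite big1 // => y /andP[/and3P[xA yA nz] xy]; case/negP: nx.
  rewrite xA; apply/finset.set0Pn; exists y.
  by rewrite !inE eq_sym xy.
have symQ x y : Q x y = Q y x.
  rewrite /Q andbCA; do 2!congr (_ && _); congr (_ != _).
  by apply/finset.setP => z; rewrite !inE andbCA.
rewrite pair_big_dep /= (bigID (fun p => (enum_rank p.1 < enum_rank p.2)%N)) /=.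
rewrite [X in _ + X](reindex_inj (inv_inj (f := fun p : T * T => (p.2, p.1)) _));
  last by case.
rewrite /= [X in _ + X](eq_bigl (fun p : T * T =>
  (Q p.1 p.2 && (p.1 != p.2)) && (enum_rank p.1 < enum_rank p.2)%N)); last first.
  move=> [x y] /=; rewrite symQ eq_sym -leqNgt leq_eqVlt.
  case: eqVneq => [->|nxy]; first by rewrite andbF.
  by rewrite (inj_eq val_inj) (inj_eq enum_rank_inj) (negPf nxy).
rewrite -big_split big1 //= => -[x y] /= /andP[/andP[/and3P[xA yA _] _] xy].
have [e1 e2] := face_sign_lt xA xy.
have -> : t y x = - t x y; last by rewrite subrr.
rewrite /t e1 e2 -scaleNr mulrN opprK mulrC; congr (_ *: basis_chain _).
by apply/finset.setP => z; rewrite !inE andbCA.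
Qed.

Lemma boundaries_cycles n K : (boundaries n K <= cycles n K)%VS.
Proof.
rewrite subv_cap; apply/andP; split; last first.
  apply/subvP => c /memv_imgP[c' _ ->].
  by rewrite memv_ker boundary_boundary.
rewrite /boundaries /chains limg_span; apply/span_subvP => _ /mapP[_ /mapP[A] + -> ->].
rewrite mem_filter mem_enum => /andP[/eqP sA KA].
rewrite boundary_basis; apply: memv_suml => x /andP[xA nz].
apply/memvZ/memv_span/mapP; exists (A :\ x) => //.
rewrite mem_filter mem_enum (simplices_sub KA nz (subsetDl _ _)) andbT.
by move: sA; rewrite (cardsD1 x) xA add1n => -[->].
Qed.

Definition boundaries_in n K : {vspace subvs_of (cycles n K)} :=
  (linfun vsval @^-1: boundaries n K)%VS.

Definition homology n K : vectType F := quotv (boundaries_in n K).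

Section Inclusion.
Variables (n : nat) (K L : simplicial_complex T).

Lemma chains_sub m : simplices K \subset simplices L ->
  (chains m K <= chains m L)%VS.
Proof.
move=> /fintype.subsetP KL; apply: sub_span => c /mapP[A].
rewrite mem_filter mem_enum => /andP[sA KA] ->.
by apply/mapP; exists A => //; rewrite mem_filter sA mem_enum KL.
Qed.

Lemma cycles_sub : simplices K \subset simplices L ->
  (cycles n K <= cycles n L)%VS.
Proof. by move=> KL; apply: capvS => //; apply: chains_sub. Qed.

Definition cycles_incl : {linear subvs_of (cycles n K) -> subvs_of (cycles n L)} :=
  vsproj (cycles n L) \o vsval.

Lemma cycles_inclE (KL : simplices K \subset simplices L) z :
  vsval (cycles_incl z) = vsval z.
Proof. by rewrite /= vsprojK // (subvP (cycles_sub KL)) ?subvsP. Qed.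

Lemma cycles_incl_boundaries (KL : simplices K \subset simplices L) z :
  z \in boundaries_in n K -> cycles_incl z \in boundaries_in n L.
Proof.
rewrite -!memv_preim !lfunE /= -/(cycles_incl z) => zB.
by rewrite vsprojK ?(subvP (cycles_sub KL)) ?subvsP //;
  apply: subvP zB; apply/limgS/chains_sub.
Qed.

(* [z] |-> [z], for z a cycle of K, seen as a cycle of L.                     *)
Definition homology_map (KL : simplices K \subset simplices L) :
    {linear homology n K -> homology n L} :=
  quotv_map (cycles_incl_boundaries KL).

End Inclusion.

End Homology.

Record filtration d (P : porderType d) (T : finType) := Filtration {
  fil_complex :> P -> simplicial_complex T;
  fil_mono : forall p q : P, (p <= q)%O ->
    simplices (fil_complex p) \subset simplices (fil_complex q) }.

Section PersistentHomology.
Variables (F : fieldType) (n : nat) (d : Order.disp_t) (P : porderType d).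
Variables (T : finType) (K : filtration P T).

Definition persistent_homology_pmod : pmod F P.
Proof.
refine (@Pmod F d P (fun p => homology F n (K p))
  (fun p q h => homology_map F n (fil_mono K h)) _ _).
- move=> p h x; rewrite -[x]quotv_reprK /= quotv_map_pi; congr quotv_pi.
  by apply: val_inj; apply: cycles_inclE; apply: fil_mono.
- move=> p q r hpq hqr hpr x; rewrite -[x]quotv_reprK /= !quotv_map_pi.
  congr quotv_pi; apply: val_inj.
  rewrite [LHS](cycles_inclE (fil_mono K hpr)).
  by rewrite [RHS](cycles_inclE (fil_mono K hqr)) [RHS](cycles_inclE (fil_mono K hpq)).
Defined.

Fact persistent_homology_fd : pointwise_fd persistent_homology_pmod.
Proof.
move=> p; have [h hlin hbij] := quotv_vect_iso (boundaries_in F n (K p)).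
pose hL := GRing.isLinear.Build F (homology F n (K p)) _ *:%R h hlin.
pose h' : {linear homology F n (K p) -> 'rV[F]__} := HB.pack h hL.
by eexists; exists h'.
Qed.

Definition persistent_homology : vecmod F P := Vecmod persistent_homology_fd.

End PersistentHomology.

Record aug_metric_space (R : realType) := AugMetricSpace {
  ams_point :> finType;
  ams_dist : ams_point -> ams_point -> R;
  ams_dist_eq0 : forall x y, ams_dist x y = 0 <-> x = y;
  ams_dist_sym : forall x y, ams_dist x y = ams_dist y x;
  ams_dist_triangle : forall x y z,
    ams_dist x z <= ams_dist x y + ams_dist y z;
  ams_fun : ams_point -> R }.

Section Rips.
Variables (R : realType) (X : aug_metric_space R).

Definition ultrametric : Prop :=
  forall x x' x'' : X,
    ams_dist x x'' <= Num.max (ams_dist x x') (ams_dist x' x'').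

Definition sublevel (s : R) : {set X} := [set x | ams_fun x <= s].

Definition rips_simplices (S : {set X}) (e : R) : {set {set X}} :=
  [set A : {set X} | [&& A != finset.set0, A \subset S &
    [forall a in A, [forall a' in A, ams_dist a a' <= e]]]].

Fact rips_simplices_neq0 S e A : A \in rips_simplices S e -> A != finset.set0.
Proof. by rewrite inE => /and3P[]. Qed.

Fact rips_simplices_sub S e (A B : {set X}) : A \in rips_simplices S e ->
  B != finset.set0 -> B \subset A -> B \in rips_simplices S e.
Proof.
rewrite !inE => /and3P[_ AS /forall_inP dA] -> BA /=.
rewrite (fintype.subset_trans BA AS) /=; apply/forall_inP => a aB.
apply/forall_inP => a' a'B; have /forall_inP := dA a (fintype.subsetP BA a aB).
by apply; apply: (fintype.subsetP BA).
Qed.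

Definition rips (S : {set X}) (e : R) : simplicial_complex X :=
  SimplicialComplex (@rips_simplices_neq0 S e) (@rips_simplices_sub S e).

(* R *p R carries the product order. *)
Definition rips_at (p : (R *p R)%type) : simplicial_complex X :=
  rips (sublevel p.1) p.2.

Fact rips_at_mono (p q : (R *p R)%type) : (p <= q)%O ->
  simplices (rips_at p) \subset simplices (rips_at q).
Proof.
rewrite leEprod => /andP[h1 h2]; apply/fintype.subsetP => A.
rewrite !inE => /and3P[-> /fintype.subsetP AS /forall_inP dA] /=; apply/andP; split.
  by apply/fintype.subsetP => x /AS; rewrite !inE => /le_trans; apply.
apply/forall_inP => a aA; apply/forall_inP => a' a'A.
by have /forall_inP/(_ _ a'A)/le_trans := dA a aA; apply.
Qed.

Definition rips_bifiltration : filtration (R *p R)%type X :=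
  Filtration rips_at_mono.

End Rips.

Definition infinite_rectangle (R : realType) (J : set (R * R)) : Prop :=
  (exists (a c : R) (b d : \bar R), [/\ b != -oo%E, d != -oo%E &
     J = [set p | (a <= p.1 /\ (p.1%:E < b)%E) /\ (c <= p.2 /\ (p.2%:E < d)%E)]])
  /\ ~ bounded_set J.

(* Main.v *)
Require Import Defs.
From HB Require Import structures.
From mathcomp Require Import all_boot all_order all_algebra.
From mathcomp Require Import boolp classical_sets cardinality.
From mathcomp Require Import reals prodnormedzmodule ereal normedtype.
Set Implicit Arguments.
Unset Strict Implicit.
Unset Printing Implicit Defensive.
Import Order.TTheory GRing.Theory Num.Theory numFieldNormedType.Exports.
Local Open Scope classical_set_scope.
Local Open Scope ring_scope.

(* Elder rule. Order the points by age, compatibly with [f]; let y be an older point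
   nearest to x. In the ultrametric, the class [x] - [y] (or [x] for the oldest point)
   lives exactly on [f x, oo) x [0, d(x, y)): at scales at least d(x, y) it vanishes, and
   below that x is the oldest point of its cluster. Wherever they live, these classes
   form a basis of H_0, by a triangularity argument along the ages, and the internal maps
   send basis elements to basis elements or to 0. Any other barcode consists of the same
   intervals, by a Krull-Schmidt argument. *)

(** * Interval modules and their barcodes *)

(** [bijective] is a mere proposition. An inverse given as data can be taken at every grade [p] at
    once. *)
Lemma bij_inverse (T U : Type) (f : T -> U) : bijective f ->
  {g : U -> T | cancel f g & cancel g f}.
Proof.
move=> fbij; have : exists g : U -> T, cancel f g /\ cancel g f.
  by case: fbij => g fK gK; exists g.
by case/cid => g [fK gK]; exists g.
Qed.

Section PersistenceModules.
Variables (F : fieldType) (d : Order.disp_t) (P : porderType d).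
Implicit Types M N : pmod F P.

Definition pmod_natural M N (phi : forall p, {linear M p -> N p}) :=
  forall p q (h : (p <= q)%O) v, phi q (pm_map M h v) = pm_map N h (phi p v).

(** Linearity and naturality of the pointwise inverse follow from those of [phi], by injectivity. *)
Lemma pmod_iso_inverse M N : pmod_iso M N ->
  exists (phi : forall p, {linear M p -> N p})
         (psi : forall p, {linear N p -> M p}),
    [/\ pmod_natural phi, pmod_natural psi,
        forall p, cancel (phi p) (psi p) & forall p, cancel (psi p) (phi p)].
Proof.
case=> phi [phib phin].
pose g p := s2val (bij_inverse (phib p)).
have phiK p : cancel (phi p) (g p) by exact: (s2valP (bij_inverse (phib p))).
have gK p : cancel (g p) (phi p) by exact: (s2valP' (bij_inverse (phib p))).
have glin p : linear (g p).
  move=> a u v; apply: (can_inj (phiK p)).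
  by rewrite linearP !gK.
pose gL p := GRing.isLinear.Build F (N p) (M p) _ (g p) (glin p).
pose psi p : {linear N p -> M p} := HB.pack (g p) (gL p).
exists phi, psi; split=> // p q h v.
by apply: (can_inj (phiK q)); rewrite phin /= !gK.
Qed.

Lemma pmod_iso_sym M N : pmod_iso M N -> pmod_iso N M.
Proof.
case/pmod_iso_inverse=> phi [psi [phin psin phiK psiK]].
exists psi; split=> [p|]; last exact: psin.
exact: Bijective (psiK p) (phiK p).
Qed.

Lemma pmod_iso_trans L M N : pmod_iso L M -> pmod_iso M N -> pmod_iso L N.
Proof.
case=> f [fb fn] [g [gb gn]].
exists (fun p => [the {linear L p -> N p} of g p \o f p]); split=> [p|p q h v] /=.
  exact: bij_comp (gb p) (fb p).
by rewrite fn gn.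
Qed.

Section IntervalModule.
Variable J : poset_interval P.

(** Vectors at [p] are rows of length 1 or 0. Summing the entries gives the coordinate along
    [interval_gen] in both cases, with no transport along the decision whether [p] lies in [J]. *)
Definition interval_coef p (v : interval_pmod F J p) : F :=
  \sum_j (v : 'rV[F]_(`[< interval_set J p >])) 0 j.

Definition interval_gen p : interval_pmod F J p :=
  (const_mx 1 : 'rV[F]_(`[< interval_set J p >])).

Lemma interval_coef_linear p : linear_for *%R (@interval_coef p).
Proof.
move=> a u v; rewrite /interval_coef mulr_sumr -big_split /=.
by apply: eq_bigr => j _; rewrite !mxE.
Qed.

HB.instance Definition _ p := GRing.isLinear.Build F (interval_pmod F J p) F *%R
  (@interval_coef p) (@interval_coef_linear p).

Lemma interval_coefK p (v : interval_pmod F J p) :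
  interval_coef v *: interval_gen p = v.
Proof.
rewrite /interval_coef /interval_gen /= /interval_obj.
move: v; rewrite /= /interval_obj; case: `[< _ >] => v; apply/matrixP => i j.
  by rewrite !mxE mulr1 (ord1 i) (ord1 j) big_ord1.
by case: j.
Qed.

Lemma interval_coef_gen p : interval_set J p -> interval_coef (interval_gen p) = 1.
Proof.
rewrite /interval_coef /interval_gen; case: asboolP => // _ _.
by rewrite big_ord1 mxE.
Qed.

Lemma interval_gen_neq0 p : interval_set J p -> interval_gen p != 0.
Proof.
move=> Jp; apply: contra_eq_neq (interval_coef_gen Jp) => ->.
by rewrite linear0 eq_sym oner_neq0.
Qed.

Lemma interval_outside p (v : interval_pmod F J p) : ~ interval_set J p -> v = 0.
Proof.
move: v; rewrite /= /interval_obj; case: asboolP => // _ v _.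
by apply/matrixP => i [].
Qed.

(** For [p] outside [J] the source is zero, so both coefficients vanish; only [q] must lie in
    [J]. *)
Lemma interval_coef_map p q (h : (p <= q)%O) (v : interval_pmod F J p) :
  interval_set J q -> interval_coef (pm_map (interval_pmod F J) h v) = interval_coef v.
Proof.
rewrite /interval_coef /=; move: v; rewrite /= /interval_obj.
case: (asboolP (interval_set J q)) => // _; case: `[< _ >] => v _.
  by rewrite !big_ord1 mxE big_ord1 mxE /= mulr1.
by rewrite big_ord0 big_ord1 mxE big_ord0.
Qed.

Lemma interval_gen_map p q (h : (p <= q)%O) : interval_set J p ->
  interval_set J q -> pm_map (interval_pmod F J) h (interval_gen p) = interval_gen q.
Proof.
move=> Jp Jq; rewrite -[LHS]interval_coefK interval_coef_map //.
by rewrite interval_coef_gen // scale1r.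
Qed.

(** At each [p] the value is at most one-dimensional, so [h p] is a scalar. Naturality equates the
    scalars at comparable points of [J], and connectedness propagates the equality to all of [J]. *)
Lemma interval_endo_scalar
    (h : forall p, {linear interval_pmod F J p -> interval_pmod F J p}) :
  pmod_natural h -> exists c, forall p v, h p v = c *: v.
Proof.
move=> hn; pose c p := interval_coef (h p (interval_gen p)).
have c_le p q : (p <= q)%O -> interval_set J p -> interval_set J q -> c q = c p.
  move=> pq Jp Jq.
  by rewrite /c -(interval_gen_map pq Jp Jq) hn interval_coef_map.
have c_path s : forall p, interval_set J p ->
    (forall q, q \in s -> interval_set J q) ->
    path (fun x y => x >=< y)%O p s -> c (last p s) = c p.
  elim: s => //= q s IHs p Jp Js /andP[pq /IHs ->] //.
  - have Jq : interval_set J q by apply: Js; rewrite mem_head.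
    by case/orP: pq => pq; [apply: c_le|symmetry; apply: c_le].
  - by apply: Js; rewrite mem_head.
  - by move=> r rs; apply: Js; rewrite in_cons rs orbT.
have [p0 Jp0] := interval_nonempty J.
exists (c p0) => p v; have [Jp|nJp] := pselect (interval_set J p); last first.
  by rewrite (interval_outside v nJp) linear0 scaler0.
have [s [ps sp Js]] := interval_connected Jp0 Jp.
have := c_path _ _ Jp0 Js ps; rewrite sp => <-.
rewrite -{1}[v]interval_coefK linearZ /=.
rewrite -[h _ _]interval_coefK -/(c _) scalerA mulrC -scalerA.
by rewrite interval_coefK.
Qed.

End IntervalModule.

(** * Barcodes from compatible bases *)

Section BasisBarcode.
Variables (M : vecmod F P) (I : finType) (J : I -> poset_interval P).
Variable e : forall (i : I) p, M p.
(** Nothing is asked of [q]: together with [e_outside], this sends a basis element to 0 once it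
    leaves its interval. *)
Hypothesis e_map : forall i p q (h : (p <= q)%O), interval_set (J i) p ->
  pm_map M h (e i p) = e i q.
Hypothesis e_outside : forall i p, ~ interval_set (J i) p -> e i p = 0.
Hypothesis e_span : forall p (v : M p), exists c : I -> F, v = \sum_i c i *: e i p.
Hypothesis e_free : forall p (c : I -> F), \sum_i c i *: e i p = 0 ->
  forall i, interval_set (J i) p -> c i = 0.

Let N := pmod_dsum (fun i => interval_module F (J i)).

Definition basis_map p (f : N p) : M p := \sum_i interval_coef (f i) *: e i p.

Lemma basis_map_linear p : linear (@basis_map p).
Proof.
move=> a f g; rewrite /basis_map scaler_sumr -big_split /=.
by apply: eq_bigr => i _; rewrite linearP scalerDl scalerA.
Qed.

HB.instance Definition _ p := GRing.isLinear.Build F (N p) (M p) _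
  (@basis_map p) (@basis_map_linear p).

Lemma basis_map_inj p : injective (@basis_map p).
Proof.
move=> f g fg; apply/eqP; rewrite -subr_eq0; apply/eqP.
have : basis_map (f - g) = 0 by rewrite linearB /= fg subrr.
move=> /e_free fg0; apply: dsumP => i; rewrite -[LHS]interval_coefK.
have [/fg0 ->|nJ] := pselect (interval_set (J i) p); first by rewrite scale0r.
by rewrite [interval_gen _ _]interval_outside // scaler0.
Qed.

Lemma basis_map_surj p (v : M p) : exists f, basis_map f = v.
Proof.
have [c ->] := e_span v.
have fin : finite_set [set i | c i *: interval_gen (J i) p != 0].
  exact: finite_finset.
exists (Dsum fin); apply: eq_bigr => i _ /=; rewrite linearZ /=.
have [Jp|nJ] := pselect (interval_set (J i) p).
  by rewrite interval_coef_gen // mulr1.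
by rewrite (e_outside nJ) !scaler0.
Qed.

Lemma basis_barcode : is_barcode M (IntervalMultiset J).
Proof.
apply: pmod_iso_sym.
exists (fun p => [the {linear N p -> M p} of @basis_map p]); split=> [p|p q h f] /=.
  have [g gK] := choice (@basis_map_surj p).
  by exists g => // f; apply: basis_map_inj; rewrite gK.
rewrite /basis_map linear_sum; apply: eq_bigr => i _.
rewrite [RHS]linearZ -[LHS]/(interval_coef (pm_map (interval_pmod F (J i)) h (f i)) *: e i q).
have [Jp|nJp] := pselect (interval_set (J i) p); last first.
  rewrite [f i]interval_outside //.
  by rewrite !linear0 scale0r /= scale0r.
rewrite /= e_map //.
have [Jq|nJq] := pselect (interval_set (J i) q); last by rewrite e_outside // !scaler0.
by rewrite interval_coef_map.
Qed.

End BasisBarcode.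

(** * Matrix entries and uniqueness of barcodes *)

Section DirectSumSingle.
Variables (I : Type) (V : I -> lmodType F).

(** The index type need not have decidable equality, hence the classical test and the transport of
    [v] along the equality; proof irrelevance makes the transport trivial at [i] itself. *)
Definition dsum_single_fun i (v : V i) j : V j :=
  if pselect (i = j) is left eij then eq_rect i V v j eij else 0.

Lemma dsum_single_fin i (v : V i) : finite_set [set j | dsum_single_fun v j != 0].
Proof.
apply: (sub_finite_set _ (finite_set1 i)) => j /=.
by rewrite /dsum_single_fun; case: pselect => // _; rewrite eqxx.
Qed.

Definition dsum_single i v : dsum V := Dsum (@dsum_single_fin i v).

Lemma dsum_single_id i (v : V i) : dsum_single v i = v.
Proof.
rewrite /= /dsum_single_fun; case: pselect => // e.
by rewrite (Prop_irrelevance e erefl).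
Qed.

Lemma dsum_single_neq i j (v : V i) : i <> j -> dsum_single v j = 0.
Proof. by rewrite /= /dsum_single_fun; case: pselect. Qed.

Fact dsum_single_linear i : linear (@dsum_single i).
Proof.
move=> a u v; apply: dsumP => j /=; rewrite /dsum_single_fun.
by case: pselect => [eij|_]; [case: j / eij|rewrite scaler0 addr0].
Qed.
HB.instance Definition _ i := GRing.isLinear.Build F (V i) (dsum V) _
  (@dsum_single i) (@dsum_single_linear i).

Definition dsum_proj i (f : dsum V) : V i := f i.

Fact dsum_proj_linear i : linear (@dsum_proj i).
Proof. by []. Qed.
HB.instance Definition _ i := GRing.isLinear.Build F (dsum V) (V i) _
  (@dsum_proj i) (@dsum_proj_linear i).

End DirectSumSingle.

Lemma dsum_single_sum (I : finType) (V : I -> lmodType F) (f : dsum V) :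
  f = \sum_i dsum_single (f i).
Proof.
apply: dsumP => i; rewrite -[RHS]/(dsum_proj i _) linear_sum (bigD1 i) //=.
rewrite [X in X + _]dsum_single_id big1 ?addr0 // => j ji.
by apply: dsum_single_neq; apply/eqP.
Qed.

Lemma dsum_map_single I (V W : I -> lmodType F) (phi : forall i, {linear V i -> W i})
    i (v : V i) : dsum_map phi (dsum_single v) = dsum_single (phi i v).
Proof.
apply: dsumP => j; rewrite -[LHS]/(phi j (dsum_single v j)).
have [eij|ij] := pselect (i = j); last by rewrite !dsum_single_neq // linear0.
by case: j / eij; rewrite !dsum_single_id.
Qed.

Section MatrixEntry.
Variables (I I' : Type) (V : I -> lmodType F) (W : I' -> lmodType F).
Variable g : {linear dsum V -> dsum W}.

Definition dsum_entry i j : {linear V i -> W j} :=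
  dsum_proj j \o (g \o dsum_single (i := i)).

End MatrixEntry.

(* The identity of [I^(B i)] is the sum over [x] of its endomorphisms factoring through
   [I^(J x)]. Endomorphisms of interval modules are scalars, so one of these is
   invertible, and then so is the reverse composite on [I^(J x)]. *)
Lemma interval_barcode_unique (I : finType) (J : I -> poset_interval P)
    (B : interval_multiset P) (i : ims_index B) :
  pmod_iso (pmod_dsum (fun x => interval_module F (J x)))
           (pmod_dsum (fun j => interval_module F (B j))) ->
  exists x, interval_set (B i) = interval_set (J x).
Proof.
case/pmod_iso_inverse => phi [psi [phin psin phiK psiK]].
pose A x p : {linear interval_pmod F (B i) p -> interval_pmod F (J x) p} :=
  dsum_entry (psi p) i x.
pose C x p : {linear interval_pmod F (J x) p -> interval_pmod F (B i) p} :=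
  dsum_entry (phi p) x i.
have An x : pmod_natural (A x).
  move=> p q h v; rewrite /= -(dsum_map_single (fun j => pm_map (interval_pmod F (B j)) h)).
  exact: (congr1 (dsum_proj x) (psin p q h _)).
have Cn x : pmod_natural (C x).
  move=> p q h v; rewrite /= -(dsum_map_single (fun j => pm_map (interval_pmod F (J j)) h)).
  exact: (congr1 (dsum_proj i) (phin p q h _)).
(* This is the component at [i] of the identity [phi \o psi], the middle vector being split over the
   finite type [I]. *)
have CA p u : \sum_x C x p (A x p u) = u.
  pose Bp j := interval_pmod F (B j) p.
  rewrite -[RHS](dsum_single_id (V := Bp)).
  rewrite -[in RHS](psiK p (dsum_single (V := Bp) u)).
  by rewrite [psi p _]dsum_single_sum linear_sum -[RHS]/(dsum_proj i _) linear_sum.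
have /choice[c cE] x : exists c, forall p v, C x p (A x p v) = c *: v.
  apply: (interval_endo_scalar (h := fun p => C x p \o A x p)).
  by move=> p q h v; rewrite -[LHS]/(C x q (A x q (pm_map _ h v))) An Cn.
have [p0 Bp0] := interval_nonempty (B i).
have [x cx0] : exists x, c x != 0.
  apply/existsP; apply: contraT; rewrite negb_exists => /forallP c0.
  have /eqP := interval_gen_neq0 Bp0; case.
  rewrite -(CA p0 (interval_gen _ _)) big1 // => x _.
  by rewrite cE; move: (c0 x); rewrite negbK => /eqP ->; rewrite scale0r.
have A_neq0 p : interval_set (B i) p -> A x p (interval_gen _ p) != 0.
  move=> Bp; apply: contraTneq (interval_gen_neq0 Bp) => A0.
  move: (cE x p (interval_gen _ p)); rewrite A0 linear0 => /esym/eqP.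
  by rewrite scaler_eq0 (negPf cx0) /= => ->.
have [c' c'E] : exists c', forall p v, A x p (C x p v) = c' *: v.
  apply: (interval_endo_scalar (h := fun p => A x p \o C x p)).
  by move=> p q h v; rewrite -[LHS]/(A x q (C x q (pm_map _ h v))) Cn An.
(* On the generator at [p0], [A C A] is both [c x *: A] and [c' *: A], and [A] is nonzero there. *)
have c'0 : c' != 0.
  apply: contraTneq (A_neq0 _ Bp0) => c'0.
  move: (c'E p0 (A x p0 (interval_gen _ p0))).
  by rewrite cE linearZ c'0 scale0r => /eqP; rewrite scaler_eq0 (negPf cx0) /= => ->.
(* Both composites are nonzero scalars, so neither module can vanish at a grade where the other does
   not. *)
exists x; apply/seteqP; split=> p.
  move=> Bp; apply: contrapT => nJ; have /eqP := A_neq0 p Bp; apply.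
  exact: interval_outside.
move=> Jp; apply: contrapT => nB; move/eqP: (interval_gen_neq0 Jp); apply.
apply/eqP; move: (c'E p (interval_gen _ p)).
rewrite [C x p _]interval_outside // linear0 => /esym/eqP.
by rewrite scaler_eq0 (negPf c'0).
Qed.

End PersistenceModules.

(** * Degree-0 homology of a simplicial complex *)

Section H0.
Variables (F : fieldType) (T : finType).
Implicit Types (K L : simplicial_complex T) (x y : T).

(** The only face of a vertex is empty, and empty faces are discarded. *)
Lemma boundary_vertex x : boundary F T (basis_chain F [set x]%SET) = 0.
Proof.
rewrite boundary_basis big1 // => y /andP[].
by rewrite !inE => /eqP ->; rewrite finset.setDv eqxx.
Qed.

Lemma boundary_edge x y : (enum_rank x < enum_rank y)%N ->
  boundary F T (basis_chain F [set x; y]%SET) =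
  basis_chain F [set y]%SET - basis_chain F [set x]%SET.
Proof.
move=> xy; have nxy : x != y by apply: contraTneq xy => ->; rewrite ltnn.
have Dx : ([set x; y] :\ x = [set y])%SET.
  by apply/finset.setP => z; rewrite !inE; case: (eqVneq z x) => // ->; rewrite (negPf nxy).
have Dy : ([set x; y] :\ y = [set x])%SET.
  apply/finset.setP => z; rewrite !inE; case: (eqVneq z y) => // [->|]; last by rewrite orbF.
  by rewrite eq_sym (negPf nxy).
have sign1 z : face_sign F [set z]%SET z = 1.
  rewrite /face_sign eq_card0 ?expr0 // => w; rewrite !inE.
  by case: eqVneq => // ->; rewrite ltnn.
have xA : x \in [set x; y]%SET by rewrite !inE eqxx.
(* Deleting one vertex relates the two signs in the edge to signs in singletons, which are 1. *)
have [ex ey] := face_sign_lt F xA xy.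
rewrite boundary_basis (bigD1 x) /=; last first.
  by rewrite Dx xA; apply/set0Pn; exists y; rewrite inE.
rewrite (bigD1 y) /=; last first.
  by rewrite Dy !inE eqxx orbT [y == x]eq_sym nxy andbT; apply/set0Pn; exists x; rewrite inE.
rewrite big1 => [|z /andP[/andP[/andP[+ _] zx] zy]]; last first.
  by rewrite !inE (negPf zx) (negPf zy).
rewrite Dx Dy addr0.
have -> : face_sign F [set x; y]%SET x = 1 by rewrite -ex Dy sign1.
have -> : face_sign F [set x; y]%SET y = -1.
  by apply: oppr_inj; rewrite -ey Dx sign1 opprK.
by rewrite scale1r scaleN1r.
Qed.

Lemma edge_boundaries K x y : [set x; y]%SET \in simplices K ->
  basis_chain F [set x]%SET - basis_chain F [set y]%SET \in boundaries F 0 K.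
Proof.
have edge u v : (enum_rank u < enum_rank v)%N -> [set u; v]%SET \in simplices K ->
    basis_chain F [set v]%SET - basis_chain F [set u]%SET \in boundaries F 0 K.
  move=> uv Kuv; rewrite -boundary_edge //; apply/memv_img/memv_span/mapP.
  exists [set u; v]%SET => //; rewrite mem_filter mem_enum Kuv andbT cards2.
  by case: (eqVneq u v) uv => // ->; rewrite ltnn.
(* Edges are oriented by [enum_rank]: reversing the order only changes the sign, and a degenerate
   edge gives difference 0. *)
case: (ltngtP (enum_rank x) (enum_rank y)) => [xy|yx|exy] Kxy.
- by rewrite -opprB rpredN edge.
- by rewrite edge // finset.setUC.
- by rewrite (enum_rank_inj (val_inj exy)) subrr rpred0.
Qed.

Lemma vertex_cycles K x : [set x]%SET \in simplices K ->
  basis_chain F [set x]%SET \in cycles F 0 K.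
Proof.
move=> Kx; rewrite memv_cap memv_ker boundary_vertex eqxx andbT.
by apply/memv_span/mapP; exists [set x]%SET => //; rewrite mem_filter mem_enum Kx cards1.
Qed.

(* Junk unless [x] is a vertex of [K]: [vsproj] is then a mere projection. *)
Definition vertex_class K x : homology F 0 K :=
  quotv_pi (boundaries_in F 0 K) (vsproj (cycles F 0 K) (basis_chain F [set x]%SET)).

Lemma vertex_class_edge K x y : [set x; y]%SET \in simplices K ->
  vertex_class K x = vertex_class K y.
Proof.
move=> Kxy; apply/quotv_piP; rewrite -linearB /= -memv_preim lfunE /=.
have Kx : [set x]%SET \in simplices K.
  apply: simplices_sub Kxy _ _; last by rewrite finset.subsetUl.
  by apply/set0Pn; exists x; rewrite inE.
have Ky : [set y]%SET \in simplices K.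
  apply: simplices_sub Kxy _ _; last by rewrite finset.subsetUr.
  by apply/set0Pn; exists y; rewrite inE.
by rewrite vsprojK ?edge_boundaries // rpredB ?vertex_cycles.
Qed.

Lemma vertex_class_incl K L (KL : simplices K \subset simplices L) x :
  [set x]%SET \in simplices K ->
  homology_map F 0 KL (vertex_class K x) = vertex_class L x.
Proof.
move=> Kx; rewrite /= quotv_map_pi; congr quotv_pi; apply: val_inj.
rewrite [LHS](cycles_inclE KL) [LHS]vsprojK ?vertex_cycles //.
by rewrite [RHS]vsprojK // vertex_cycles // (fintype.subsetP KL).
Qed.

(** Spanning is phrased through a subspace [U], so that membership of the vertex classes can be
    proved by induction on age. *)
Lemma vertex_class_span K (U : {vspace homology F 0 K}) :
  (forall x, [set x]%SET \in simplices K -> vertex_class K x \in U) ->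
  forall v, v \in U.
Proof.
move=> KU v; rewrite -[v]quotv_reprK; set z := quotv_repr v.
(* Through [vsproj], [f] is defined on all chains, so the inclusion can be tested on the basis
   chains spanning [chains F 0 K]. *)
pose f := linfun (quotv_pi (boundaries_in F 0 K) \o vsproj (cycles F 0 K)).
suff /subvP/(_ (vsval z)) : (chains F 0 K <= f @^-1: U)%VS.
  rewrite -memv_preim lfunE /= vsvalK; apply.
  by have := subvsP z; rewrite memv_cap => /andP[].
apply/span_subvP => _ /mapP[A + ->]; rewrite mem_filter mem_enum.
case/andP=> /cards1P[x ->] Kx; rewrite -memv_preim lfunE /=; exact: KU.
Qed.

(** A function on vertices that is constant along edges is a 0-cocycle: its linear extension kills
    boundaries and descends to the quotient. *)
Lemma H0_functional K (lam : T -> F) :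
  (forall x y, [set x; y]%SET \in simplices K -> lam x = lam y) ->
  exists l : {linear homology F 0 K -> F^o},
    forall x, [set x]%SET \in simplices K -> l (vertex_class K x) = lam x.
Proof.
move=> lamK.
pose L0 (c : chain F T) : F^o := \sum_x c [set x]%SET * lam x.
have L0lin : linear L0.
  move=> a c c'; rewrite /L0 scaler_sumr -big_split /=.
  by apply: eq_bigr => x _; rewrite !ffunE mulrDl scalerAl.
pose L : {linear chain F T -> F^o} :=
  HB.pack L0 (GRing.isLinear.Build F (chain F T) F^o _ L0 L0lin).
have L_vertex x : L (basis_chain F [set x]%SET) = lam x.
  rewrite /= /L0 (bigD1 x) //= big1 ?addr0 => [|y yx]; first by rewrite ffunE eqxx mul1r.
  by rewrite ffunE (inj_eq set1_inj) (negPf yx) mul0r.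
have L_boundaries c : c \in boundaries F 0 K -> L c = 0.
  suff /subvP sub : (boundaries F 0 K <= lker (linfun L))%VS.
    by move=> /sub; rewrite memv_ker lfunE => /eqP.
  rewrite /boundaries /chains limg_span; apply/span_subvP => _ /mapP[_ /mapP[A + ->] ->].
  rewrite mem_filter mem_enum => /andP[/cards2P[x [y [nxy ->]]] Kxy].
  rewrite memv_ker lfunE.
  case: (ltngtP (enum_rank x) (enum_rank y)) => [xy|yx|exy].
  - by rewrite boundary_edge // linearB !L_vertex (lamK x y) // subrr.
  - rewrite finset.setUC boundary_edge // linearB !L_vertex.
    by rewrite (lamK x y) // subrr.
  - by rewrite (enum_rank_inj (val_inj exy)) eqxx in nxy.
pose l0 (v : homology F 0 K) : F^o := L (vsval (quotv_repr v)).
have l0_pi z : l0 (quotv_pi (boundaries_in F 0 K) z) = L (vsval z).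
  apply/eqP; rewrite -subr_eq0 -linearB /= -linearB /=; apply/eqP/L_boundaries.
  have : quotv_repr (quotv_pi (boundaries_in F 0 K) z) - z \in boundaries_in F 0 K.
    by apply/quotv_piP; rewrite quotv_reprK.
  by rewrite -memv_preim lfunE.
have l0lin : linear l0.
  move=> a u v; rewrite -[u]quotv_reprK -[v]quotv_reprK -linearP !l0_pi.
  by rewrite !linearP.
pose l : {linear homology F 0 K -> F^o} :=
  HB.pack l0 (GRing.isLinear.Build F (homology F 0 K) F^o _ l0 l0lin).
by exists l; move=> x Kx; rewrite /= l0_pi vsprojK ?vertex_cycles // L_vertex.
Qed.

End H0.

(** * The elder rule in an ultrametric space *)

Section HalfStrip.
Variables (R : realType) (a c : R) (b : \bar R).
Hypothesis cb : (c%:E < b)%E.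

Definition half_strip_set : set (R *p R)%type :=
  [set p | a <= p.1 /\ (c <= p.2 /\ (p.2%:E < b)%E)].

Lemma half_strip_nonempty : half_strip_set !=set0.
Proof. by exists (a, c); split=> //=. Qed.

Lemma half_strip_convex (p q r : (R *p R)%type) : half_strip_set p -> half_strip_set q ->
  (p <= r)%O -> (r <= q)%O -> half_strip_set r.
Proof.
move=> [ap [cp _]] [_ [_ qb]]; rewrite !leEprod => /andP[pr1 pr2] /andP[_ rq2].
split; first exact: le_trans ap pr1.
by split; [exact: le_trans cp pr2|apply: le_lt_trans qb; rewrite lee_fin].
Qed.

Lemma half_strip_connected (p q : (R *p R)%type) : half_strip_set p -> half_strip_set q ->
  exists s : seq (R *p R)%type, [/\ path (fun x y => x >=< y)%O p s, last p s = q &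
      forall r, r \in s -> half_strip_set r].
Proof.
move=> [ap [cp pb]] [aq [cq qb]].
(* Half-strips are closed under joins, so any two points are linked through their join. *)
pose r : (R *p R)%type := (Num.max p.1 q.1, Num.max p.2 q.2).
have pr : (p <= r)%O by rewrite leEprod /= !le_max !lexx.
have qr : (q <= r)%O by rewrite leEprod /= !le_max !lexx !orbT.
exists [:: r; q]; split => //=; first by rewrite !/(_ >=< _)%O pr qr orbT.
move=> x; rewrite !inE => /orP[]/eqP -> //.
split; rewrite /= ?le_max ?ap ?cp //; split=> //.
by case: (leP p.2 q.2).
Qed.

Definition half_strip : poset_interval (R *p R)%type :=
  PosetInterval half_strip_nonempty half_strip_convex half_strip_connected.

Lemma half_strip_infinite : infinite_rectangle (interval_set half_strip).
Proof.
split; last first.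
  (* Boundedness provides the bound [M + 1]. The chosen point has first coordinate at least [M + 2],
     and the maximum with [a] keeps it in the strip. *)
  case=> M [_ /(_ (M + 1))]; rewrite ltrDl ltr01 => /(_ isT).
  move=> /(_ (Num.max a (M + 2), c)); rewrite /= prod_normE /= ge_max => bnd.
  have /andP[] : (`|Num.max a (M + 2)| <= M + 1) && (`|c| <= M + 1).
    by apply: bnd; split=> //=; rewrite le_max lexx.
  move/(le_trans (ler_norm _)); rewrite ge_max lerD2l => /andP[_].
  by rewrite (ler_nat _ 2 1).
exists a, c, +oo%E, b; split=> //; first by case: b cb.
by apply/seteqP; split=> p /= => [[ap cpb]|[[ap _] cpb]]; split=> //; rewrite ltry.
Qed.

End HalfStrip.

(** * Elder classes and their lifetimes *)

Section ElderRule.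
Variables (F : fieldType) (R : realType) (X : aug_metric_space R).
Implicit Types (x y z : X) (p q : (R *p R)%type).
Notation d := (@ams_dist R X).
Notation f := (@ams_fun R X).

Lemma dist_self x : d x x = 0.
Proof. exact/ams_dist_eq0. Qed.

Lemma dist_ge0 x y : 0 <= d x y.
Proof.
have := ams_dist_triangle x y x.
by rewrite dist_self (ams_dist_sym y x) -mulr2n pmulrn_lge0.
Qed.

Lemma dist_gt0 x y : x != y -> 0 < d x y.
Proof. by move=> xy; rewrite lt0r dist_ge0 andbT; apply: contra_neq xy => /ams_dist_eq0. Qed.

(** The case [x = y] is allowed and yields the criterion for vertices. *)
Lemma rips_edgeP x y p : [set x; y]%SET \in simplices (rips_at X p) <->
  [/\ f x <= p.1, f y <= p.1, 0 <= p.2 & d x y <= p.2].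
Proof.
rewrite inE; split=> [/and3P[_ /fintype.subsetP S /forall_inP D]|[fx fy p0 xy]].
  have xA : x \in [set x; y]%SET by rewrite !inE eqxx.
  have yA : y \in [set x; y]%SET by rewrite !inE eqxx orbT.
  have := S _ xA; have := S _ yA; rewrite !inE => -> ->; split=> //.
    by rewrite -(dist_self x); apply: (forall_inP (D x xA)).
  exact: (forall_inP (D x xA)).
apply/and3P; split; first by apply/set0Pn; exists x; rewrite !inE eqxx.
  by apply/fintype.subsetP => z; rewrite !inE => /orP[]/eqP ->.
apply/forall_inP => u; rewrite !inE => /orP[]/eqP -> /=;
  apply/forall_inP => v; rewrite !inE => /orP[]/eqP -> //=; rewrite ?dist_self //.
by rewrite ams_dist_sym.
Qed.

Lemma rips_vertexP x p : [set x]%SET \in simplices (rips_at X p) <->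
  f x <= p.1 /\ 0 <= p.2.
Proof.
rewrite -[[set x]%SET]finset.setUid; split=> [/rips_edgeP[]//|[fx p0]].
by apply/rips_edgeP; rewrite dist_self.
Qed.

(** The age is the position in a list sorted by [f], which breaks ties. *)
Lemma exists_age : exists age : X -> nat, injective age /\
  forall x y, (age x <= age y)%N -> f x <= f y.
Proof.
pose le x y := f x <= f y.
pose s := sort le (enum X).
have mem_s x : x \in s by rewrite mem_sort mem_enum.
exists (fun x => index x s); split=> [x y|x y xy].
  by move/(congr1 (nth x s)); rewrite !nth_index.
apply: (sorted_leq_index (leT := le)) xy => //.
- by move=> v u w; apply: le_trans.
- by move=> u; apply: lexx.
- by apply: sort_sorted => u v; apply: le_total.
Qed.

Variable age : X -> nat.
Hypothesis age_inj : injective age.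
Hypothesis age_fun : forall x y, (age x <= age y)%N -> f x <= f y.

Lemma exists_parent : exists parent : X -> option X, forall x,
  if parent x is Some y
  then (age y < age x)%N /\ forall z, (age z < age x)%N -> d x y <= d x z
  else forall z, (age x <= age z)%N.
Proof.
pose nearest x o := if o is Some y
  then (age y < age x)%N /\ forall z, (age z < age x)%N -> d x y <= d x z
  else forall z, (age x <= age z)%N.
suff /choice[g gP] : forall x, exists o, nearest x o by exists g.
move=> x; have [[y yx]|no] := pselect (exists y, (age y < age x)%N).
  exists (Some [arg min_(z < y | (age z < age x)%N) d x z]%O).
  by case: Order.TotalTheory.arg_minP => // z zx zmin.
by exists None => z; rewrite leqNgt; apply/negP => zx; apply: no; exists z.
Qed.

Variable parent : X -> option X.
Hypothesis parentP : forall x,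
  if parent x is Some y
  then (age y < age x)%N /\ forall z, (age z < age x)%N -> d x y <= d x z
  else forall z, (age x <= age z)%N.

Definition death x : \bar R := if parent x is Some y then (d x y)%:E else +oo%E.

(** Makes the strip of [x] nonempty, as an interval must be. *)
Lemma death_gt0 x : (0%:E < death x)%E.
Proof.
rewrite /death; have := parentP x; case: (parent x) => [y [yx _]|_]; last exact: ltry.
by rewrite lte_fin dist_gt0 //; apply: contraTneq yx => ->; rewrite ltnn.
Qed.

Definition elder_strip x := half_strip (f x) (death_gt0 x).

Let H0 := persistent_homology F 0 (rips_bifiltration X).

(** The class is cut to 0 off the strip because [vertex_class] is junk before [x] appears. After the
    death of [x] the difference is 0 anyway, by [parent_edge]. *)
Definition elder_class x p : H0 p :=
  if `[< interval_set (elder_strip x) p >] then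
    vertex_class F (rips_at X p) x -
      (if parent x is Some y then vertex_class F (rips_at X p) y else 0)
  else 0.

(** An older point has no larger value of [f], so the parent is present whenever [x] is. Hence the
    death scale does not depend on the first coordinate, and lifetimes are rectangles. *)
Lemma parent_vertex x y p : parent x = Some y ->
  [set x]%SET \in simplices (rips_at X p) -> [set y]%SET \in simplices (rips_at X p).
Proof.
move=> xy /rips_vertexP[fx p0]; apply/rips_vertexP; split=> //.
have := parentP x; rewrite xy => -[/ltnW/age_fun yx _].
exact: le_trans yx fx.
Qed.

Lemma parent_edge x y p : parent x = Some y -> [set x]%SET \in simplices (rips_at X p) ->
  ~ interval_set (elder_strip x) p ->
  vertex_class F (rips_at X p) x = vertex_class F (rips_at X p) y.
Proof.
move=> xy Kx nJ; apply: vertex_class_edge; apply/rips_edgeP.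
have /rips_vertexP[fy _] := parent_vertex xy Kx.
have /rips_vertexP[fx p0] := Kx.
split=> //; rewrite leNgt; apply/negP => pxy; apply: nJ.
by split=> //; split=> //; rewrite /death xy lte_fin.
Qed.

Lemma strip_vertex x p : interval_set (elder_strip x) p ->
  [set x]%SET \in simplices (rips_at X p).
Proof. by case=> fx [p0 _]; apply/rips_vertexP. Qed.

Lemma elder_class_map x p q (h : (p <= q)%O) : interval_set (elder_strip x) p ->
  pm_map H0 h (elder_class x p) = elder_class x q.
Proof.
move=> Jp; have Kp := strip_vertex Jp.
have Kq : [set x]%SET \in simplices (rips_at X q).
  exact: (fintype.subsetP (rips_at_mono X h)).
rewrite /elder_class asboolT //.
have -> : pm_map H0 h (vertex_class F (rips_at X p) x -
      (if parent x is Some y then vertex_class F (rips_at X p) y else 0)) =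
    vertex_class F (rips_at X q) x -
      (if parent x is Some y then vertex_class F (rips_at X q) y else 0).
  rewrite linearB; congr (_ - _); first exact: vertex_class_incl.
  case xy: (parent x) => [y|]; last by rewrite linear0.
  by apply: vertex_class_incl; apply: parent_vertex xy Kp.
(* If [q] has left the strip, then [x] and its parent are joined by an edge; the oldest point never
   leaves its strip. *)
have [//|nJq] := asboolP (interval_set (elder_strip x) q).
case xy: (parent x) => [y|]; first by rewrite (parent_edge xy) // subrr.
case: nJq; have /rips_vertexP[fx q0] := Kq.
by split=> //; split=> //; rewrite /death xy ltry.
Qed.

Lemma elder_class_outside x p : ~ interval_set (elder_strip x) p -> elder_class x p = 0.
Proof. by move=> nJ; rewrite /elder_class asboolF. Qed.

(** By induction on age: the class of [x] is its elder class plus the class of its parent while [x]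
    is alive, and equals the class of its parent afterwards. *)
Lemma elder_class_span p (v : H0 p) : exists c : X -> F, v = \sum_x c x *: elder_class x p.
Proof.
(* Typed in [homology] rather than [H0 p], to make subspaces available. *)
pose e x : homology F 0 (rips_at X p) := elder_class x p.
have : v \in (\sum_x <[e x]>)%VS.
  apply: vertex_class_span v => x.
  elim: {x}(age x).+1 {-2}x (ltnSn (age x)) => // n IHn x; rewrite ltnS => xn Kx.
  have ex : e x \in (\sum_x <[e x]>)%VS.
    by apply: (subvP (sumv_sup x _ (subvv _))) => //; apply: memv_line.
  have px : (if parent x is Some y then vertex_class F (rips_at X p) y else 0)
      \in (\sum_x <[e x]>)%VS.
    case xy: (parent x) => [y|]; last exact: mem0v.
    apply: IHn; last exact: parent_vertex xy Kx.
    by have := parentP x; rewrite xy => -[yx _]; apply: leq_trans yx xn.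
  have [Jp|nJp] := pselect (interval_set (elder_strip x) p).
    by rewrite -[vertex_class _ _ _](subrK (if parent x is Some y
      then vertex_class F (rips_at X p) y else 0)) memvD //;
      move: ex; rewrite /e /elder_class asboolT.
  case xy: (parent x) px => [y|] px; first by rewrite (parent_edge xy).
  case: nJp; have /rips_vertexP[fx p0] := Kx.
  by split=> //; split=> //; rewrite /death xy ltry.
case/memv_sumP => w we ->.
have /choice[c cE] x : exists c, w x = c *: e x by apply/vlineP; apply: we.
by exists c; apply: eq_bigr => x _; rewrite cE.
Qed.

Hypothesis ultraX : ultrametric X.

(* The functional summing the coefficients over the cluster of [x] vanishes on every
   older elder class, since [x] is the oldest point of its cluster while it is alive. *)
Lemma elder_functional x p : interval_set (elder_strip x) p ->
  exists l : {linear H0 p -> F^o}, l (elder_class x p) = 1 /\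
    forall y, (age y < age x)%N -> l (elder_class y p) = 0.
Proof.
move=> Jp; have [fx [p0 px]] := Jp.
pose lam y : F := if d x y <= p.2 then 1 else 0.
(* By the ultrametric inequality, the ends of an edge are both inside or both outside the closed
   ball of radius [p.2] around [x]: this ball is the cluster of [x]. *)
have [y z Kyz|l lE] := @H0_functional F X (rips_at X p) lam.
  have /rips_edgeP[_ _ _ yz] := Kyz.
  rewrite /lam; congr (if _ then _ else _); apply/idP/idP => xy.
    by apply: le_trans (ultraX x y z) _; rewrite ge_max xy.
  by apply: le_trans (ultraX x z y) _; rewrite ge_max xy ams_dist_sym.
(* The nearest older point is at distance [death x], beyond [p.2]. *)
have lam0 y : (age y < age x)%N -> lam y = 0.
  move=> yx; have := parentP x; move: px; rewrite /= /death.
  case: (parent x) => [z|_ /(_ y)]; last by rewrite leqNgt yx.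
  rewrite lte_fin => pz [_ /(_ y yx) zy].
  by rewrite /lam leNgt (lt_le_trans pz zy).
(* The parent of [x], or of any older point, is strictly older than [x], so parent terms contribute
   nothing. *)
have lparent y : [set y]%SET \in simplices (rips_at X p) -> (age y <= age x)%N ->
    l (if parent y is Some z then vertex_class F (rips_at X p) z else 0) = 0.
  move=> Ky yx; case yz: (parent y) => [z|]; last by rewrite linear0.
  rewrite lE; last exact: parent_vertex yz Ky.
  by apply: lam0; have := parentP y; rewrite yz => -[zy _]; apply: leq_trans zy yx.
exists l; split=> [|y yx].
  have Kx := strip_vertex Jp.
  rewrite /elder_class asboolT // linearB [X in _ - X]lparent // subr0 [LHS]lE //.
  by rewrite /lam dist_self p0.
have [Jy|nJy] := pselect (interval_set (elder_strip y) p); last first.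
  by rewrite elder_class_outside // linear0.
have Ky := strip_vertex Jy.
rewrite /elder_class asboolT // linearB [X in _ - X]lparent ?(ltnW yx) //.
by rewrite subr0 [LHS]lE // lam0.
Qed.

Lemma elder_class_free p (c : X -> F) : \sum_x c x *: elder_class x p = 0 ->
  forall x, interval_set (elder_strip x) p -> c x = 0.
Proof.
move=> c0 x0 Jx0; apply/eqP/contraT => cx0.
pose Q x := `[< interval_set (elder_strip x) p >] && (c x != 0).
have Qx0 : Q x0 by rewrite /Q asboolT.
(* Take the youngest living point with nonzero coefficient. Its functional kills every other term,
   all of them dead, older or with coefficient 0, and so isolates that coefficient. *)
case: (@arg_maxnP X x0 Q age Qx0) => x /andP[/asboolP Jx cx] xmax.
have [l [lx ly]] := elder_functional Jx.
move/(congr1 l): c0; rewrite linear0 linear_sum (bigD1 x) //= big1 => [|y yx].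
  by rewrite addr0 linearZ /= lx => /eqP; rewrite /GRing.scale /= mulr1 (negPf cx).
rewrite linearZ /=.
have [->|cy] := eqVneq (c y) 0; first by rewrite scale0r.
have [Jy|nJy] := pselect (interval_set (elder_strip y) p); last first.
  by rewrite elder_class_outside // linear0 scaler0.
rewrite ly ?scaler0 // ltn_neqAle (inj_eq age_inj) yx /=.
by apply: xmax; rewrite /Q asboolT.
Qed.

Lemma elder_barcode : is_barcode H0 (IntervalMultiset elder_strip).
Proof.
apply: (basis_barcode (e := elder_class)).
- exact: elder_class_map.
- exact: elder_class_outside.
- exact: elder_class_span.
- exact: elder_class_free.
Qed.

End ElderRule.

Theorem corollary4p11 (F : fieldType) (R : realType) (X : aug_metric_space R)
    (hX : ultrametric X) :
  let H0 := persistent_homology F 0 (rips_bifiltration X) in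
  interval_decomposable H0 /\
  (forall B : interval_multiset (R *p R)%type, is_barcode H0 B ->
     forall i : ims_index B, infinite_rectangle (interval_set (B i))).
Proof.
move=> H0; have [age [age_inj age_fun]] := exists_age X.
have [parent parentP] := exists_parent age.
have elder := @elder_barcode F R X age age_inj age_fun parent parentP hX.
split=> [|B BB i]; first by eexists; exact: elder.
(* Both barcodes decompose the same module, so each interval of [B] is an elder strip. *)
have [x ->] := interval_barcode_unique i (pmod_iso_trans (pmod_iso_sym elder) BB).
exact: half_strip_infinite.
Qed.
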